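(* Let $R$ be an integral domain that is finitely generated as an algebra over a field $k$. Let $L$ be the integral closure of $k$ in $R$. Let $A=k[t,t^{-1}]$, where $t$ is an indeterminate over $k$. Then $L$ is the unique maximal subfield of $R$ containing $k$. Moreover, exactly one of the following is true: (1) $R$ is unit-additive, and the only $k$-algebra homomorphisms from $A$ to $R$ are the ones that send $t\mapsto\alpha$ for some $\alpha\in L^\times$ (i.e., $U(R)=L^\times$). None of these homomorphisms is injective. (2) $R$ is not unit-additive, and there is an injective $k$-algebra homomorphism $\varphi: A\to R$.
   Context: All rings are commutative and unital. A ring $R$ is unit-additive if whenever $u,v$ are units of $R$, $u+v$ is either a unit of $R$ or a nilpotent element. $U(R)$ denotes the group of units of $R$. *)

(* Defs.v *)
From HB Require Import structures.
From mathcomp Require Import all_boot all_order all_algebra.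
From mathcomp Require Import boolp classical_sets.

Set Implicit Arguments.
Unset Strict Implicit.
Unset Printing Implicit Defensive.

Import GRing.Theory.

Local Open Scope ring_scope.
Local Open Scope classical_set_scope.

Local Notation "x %:F" := (tofrac x).

Section Laurent.
Variable k : fieldType.

(* [k[t, t^-1]], as the subring of the field of fractions [k(t)] of [{poly k}]
   formed by the [p / t ^+ n]; membership is decided classically. *)
Definition laurent_pred : {pred {fraction {poly k}}} :=
  fun f => `[< exists (n : nat) (p : {poly k}), f * ('X^n)%:F = p%:F >].

Lemma laurent_predP f :
  reflect (exists (n : nat) (p : {poly k}), f * ('X^n)%:F = p%:F)
          (f \in laurent_pred).
Proof. exact: asboolP. Qed.

Lemma laurent_pred_poly (p : {poly k}) : p%:F \in laurent_pred.
Proof. by apply/laurent_predP; exists 0, p; rewrite expr0 rmorph1 mulr1. Qed.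

Lemma laurent_subring_closed : GRing.subring_closed laurent_pred.
Proof.
split=> [|f g|f g].
- by rewrite -(rmorph1 (@tofrac {poly k})) laurent_pred_poly.
- move=> /laurent_predP[n [p fE]] /laurent_predP[m [q gE]].
  apply/laurent_predP; exists (n + m)%N, (p * 'X^m - q * 'X^n).
  rewrite exprD rmorphB !rmorphM /= -fE -gE mulrBl mulrA.
  by congr (_ - _); rewrite -mulrA; congr (_ * _); rewrite mulrC.
- move=> /laurent_predP[n [p fE]] /laurent_predP[m [q gE]].
  apply/laurent_predP; exists (n + m)%N, (p * q).
  by rewrite exprD !rmorphM /= -fE -gE mulrACA.
Qed.

HB.instance Definition _ :=
  GRing.isSubringClosed.Build {fraction {poly k}} laurent_pred
    laurent_subring_closed.

Record laurent := Laurent {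
  laurent_val : {fraction {poly k}};
  laurent_valP : laurent_val \in laurent_pred
}.

HB.instance Definition _ := [isSub for laurent_val].
HB.instance Definition _ := [Choice of laurent by <:].
HB.instance Definition _ := [SubChoice_isSubComNzRing of laurent by <:].

Definition laurent_of_poly (p : {poly k}) : laurent := Laurent (laurent_pred_poly p).

Definition laurent_scale (c : k) (f : laurent) : laurent := laurent_of_poly c%:P * f.

Lemma laurent_scaleA a b f :
  laurent_scale a (laurent_scale b f) = laurent_scale (a * b) f.
Proof. by apply: val_inj; rewrite /= mulrA !rmorphM. Qed.

Lemma laurent_scale1 : left_id 1 laurent_scale.
Proof. by move=> f; apply: val_inj; rewrite /= !rmorph1 mul1r. Qed.

Lemma laurent_scaleDr : right_distributive laurent_scale +%R.
Proof. by move=> a f g; apply: mulrDr. Qed.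

Lemma laurent_scaleDl f : {morph laurent_scale^~ f : a b / a + b}.
Proof. by move=> a b; apply: val_inj; rewrite /= !rmorphD mulrDl. Qed.

HB.instance Definition _ := GRing.Zmodule_isLmodule.Build k laurent
  laurent_scaleA laurent_scale1 laurent_scaleDr laurent_scaleDl.

Lemma laurent_scaleAl (a : k) (f g : laurent) : a *: (f * g) = a *: f * g.
Proof. exact: mulrA. Qed.

HB.instance Definition _ :=
  GRing.Lmodule_isLalgebra.Build k laurent laurent_scaleAl.
HB.instance Definition _ := GRing.Lalgebra_isComAlgebra.Build k laurent.

Definition laurentX : laurent := laurent_of_poly 'X.

Lemma laurent_predXV : ('X : {poly k})%:F^-1 \in laurent_pred.
Proof.
apply/laurent_predP; exists 1, 1.
by rewrite expr1 mulVf ?rmorph1 // tofrac_eq0 polyX_eq0.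
Qed.

Definition laurentXV : laurent := Laurent laurent_predXV.

Lemma laurentXK : laurentX * laurentXV = 1.
Proof. by apply: val_inj; rewrite /= mulfV // tofrac_eq0 polyX_eq0. Qed.

End Laurent.

Definition nilpotent_elt (R : nzRingType) (x : R) : Prop :=
  exists n : nat, x ^+ n = 0.

Definition unit_additive (R : comUnitRingType) : Prop :=
  forall u v : R, u \is a GRing.unit -> v \is a GRing.unit ->
    u + v \is a GRing.unit \/ nilpotent_elt (u + v).

Definition fg_algebra (k : fieldType) (R : comAlgType k) : Prop :=
  exists s : seq R, forall S : set R,
    GRing.subalg_closed (mem S) -> (forall x, x \in s -> S x) -> S = setT.

Definition subfield (R : comNzRingType) (S : set R) : Prop :=
  GRing.subring_closed (mem S) /\
  (forall x, S x -> x != 0 -> exists2 y, S y & x * y = 1).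

Definition subfield_over (k : fieldType) (R : comAlgType k) (S : set R) : Prop :=
  subfield S /\ (forall c : k, S c%:A).

Definition maximal_subfield_over (k : fieldType) (R : comAlgType k)
    (S : set R) : Prop :=
  subfield_over S /\
  (forall T : set R, subfield_over T -> S `<=` T -> T = S).

Definition integral_closure (k : fieldType) (R : comAlgType k) : set R :=
  [set x | integralOver (in_alg R) x].

Definition unit_group (R : comNzRingType) (S : set R) : set R :=
  [set x | S x /\ exists2 y, S y & x * y = 1].

Arguments integral_closure {k} R _.

(* Main.v *)
(* The key point is that a subfield of R containing k is algebraic over k.
   Otherwise it contains k(x) with x transcendental, so that every nonzero
   element of k[x] is invertible in R. The property "some nonzero a in A has a
   power divisible by q, for every nonzero q in k[x]" descends from A[r] to A,
   by leading coefficients if r is transcendental over A, and by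
   pseudo-division by a polynomial of minimal degree vanishing at r otherwise.
   Adjoining the generators of R one at a time, it descends from R to k[x],
   where it fails.
   Hence L is the largest subfield containing k. If R is unit-additive, its
   units together with 0 form a subfield, so they lie in L; if R is not, some
   unit u lies outside L, and t |-> u is injective since u is transcendental. *)
Require Import Defs.
From HB Require Import structures.
From mathcomp Require Import all_boot all_order all_algebra.
From mathcomp Require Import boolp classical_sets.
From mathcomp Require Import zify ring.

Set Implicit Arguments.
Unset Strict Implicit.
Unset Printing Implicit Defensive.

Import GRing.Theory.

Local Open Scope ring_scope.
Local Open Scope classical_set_scope.

(** * Pseudo-division over a subring and adjunction of one element *)

Section Adjoin.
Variables (R : idomainType) (A : subringClosed R).
Implicit Types (p g s h : {poly R}) (r x : R).

(** Leading coefficients in [A] need not be invertible, so each cancellation of the top term of [p]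
    first multiplies [p] by [lead_coef g]; [m] counts these steps. *)
Lemma pseudo_division p g : p \is a polyOver A -> g \is a polyOver A ->
  g != 0 -> exists m s h,
  [/\ s \is a polyOver A, h \is a polyOver A, (size h < size g)%N
    & lead_coef g ^+ m *: p = s * g + h].
Proof.
move=> + Ag g0; have [n] := ubnP (size p); elim: n p => // n IHn p ltpn Ap.
have [ltpg | legp] := ltnP (size p) (size g).
  by exists 0, 0, p; rewrite expr0 scale1r mul0r add0r rpred0.
have sg_gt0 : (0 < size g)%N by rewrite size_poly_gt0.
have Alg : lead_coef g \in A by rewrite lead_coefE (polyOverP Ag).
pose c := lead_coef p *: 'X^(size p - size g).
have Ac : c \is a polyOver A.
  by rewrite polyOverZ ?polyOverXn // lead_coefE (polyOverP Ap).
pose p1 := lead_coef g *: p - c * g.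
have Ap1 : p1 \is a polyOver A by apply: rpredB; [apply: polyOverZ|apply: rpredM].
have ltp1 : (size p1 < n)%N.
  suff: (size p1 <= (size p).-1)%N by move=> /leq_ltn_trans; apply; lia.
  apply/leq_sizeP => j lej; rewrite coefB coefZ -scalerAl coefZ coefXnM.
  case: ltnP => [|lej2]; first by lia.
  have [->|ltj] : j = (size p).-1 \/ (size p <= j)%N by lia.
    have -> : ((size p).-1 - (size p - size g))%N = (size g).-1 by lia.
    by rewrite -!lead_coefE mulrC subrr.
  have legj : (size g <= j - (size p - size g))%N by lia.
  by rewrite !nth_default ?mulr0 ?subrr.
have [m [s [h [As Ah lth eqp1]]]] := IHn p1 ltp1 Ap1.
exists m.+1, (s + lead_coef g ^+ m *: c), h; split=> //.
  by apply: rpredD => //; apply: polyOverZ => //; apply: rpredX.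
rewrite mulrDl addrAC -eqp1 /p1 scalerBr scalerAl subrK.
by rewrite exprSr scalerA.
Qed.

Definition adjoin r : {pred R} :=
  fun x => `[< exists2 p, p \is a polyOver A & x = p.[r] >].

Lemma adjoinP r x :
  reflect (exists2 p, p \is a polyOver A & x = p.[r]) (x \in adjoin r).
Proof. exact: asboolP. Qed.

Lemma adjoin_subring_closed r : GRing.subring_closed (adjoin r).
Proof.
split=> [|_ _ /adjoinP[p Ap ->] /adjoinP[q Aq ->]|
  _ _ /adjoinP[p Ap ->] /adjoinP[q Aq ->]]; apply/adjoinP.
- by exists 1; rewrite ?rpred1 // hornerC.
- by exists (p - q); rewrite ?rpredB // hornerD hornerN.
- by exists (p * q); rewrite ?rpredM // hornerM.
Qed.

Lemma sub_adjoin r : {subset A <= adjoin r}.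
Proof.
by move=> a Aa; apply/adjoinP; exists a%:P; rewrite ?polyOverC ?hornerC.
Qed.

Lemma mem_adjoin r : r \in adjoin r.
Proof. by apply/adjoinP; exists 'X; rewrite ?polyOverX ?hornerX. Qed.

End Adjoin.

HB.instance Definition _ (R : idomainType) (A : subringClosed R) (r : R) :=
  GRing.isSubringClosed.Build R (adjoin A r) (adjoin_subring_closed A r).

(* The multiplicative set Q becomes invertible in the localization A[1/a]. *)
Definition inverted_by (R : idomainType) (Q : R -> Prop) (A : {pred R}) :=
  exists a, [/\ a \in A, a != 0 &
    forall q, Q q -> exists n, exists2 s, s \in A & a ^+ n = q * s].

(** * Descent of [inverted_by] from [A[r]] to [A] *)

Section Descent.
Variables (R : idomainType) (A : subringClosed R) (Q : R -> Prop).
Hypothesis QA : forall q, Q q -> q \in A.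

(** With [a = p(r)], the relation [p(r)^n = q s(r)] is an identity of polynomials because [r] is
    transcendental, and [q] is a constant. Leading coefficients then give the relation over [A]. *)
Lemma inverted_by_transcendental r :
  (forall p, p \is a polyOver A -> p.[r] = 0 -> p = 0) ->
  inverted_by Q (adjoin A r) -> inverted_by Q A.
Proof.
move=> r_tr [_ [/adjoinP[p Ap ->] pr0 Qinv]].
exists (lead_coef p); split=> [||q Qq].
- by rewrite lead_coefE (polyOverP Ap).
- by rewrite lead_coef_eq0; apply: contraNneq pr0 => ->; rewrite horner0.
have [n [_ /adjoinP[s As ->] eqs]] := Qinv q Qq.
exists n, (lead_coef s); first by rewrite lead_coefE (polyOverP As).
rewrite -lead_coef_exp -lead_coefZ; congr lead_coef; apply/eqP.
rewrite -subr_eq0; apply/eqP/r_tr.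
  by rewrite rpredB ?rpredX ?polyOverZ ?QA.
by rewrite hornerD hornerN hornerZ horner_exp eqs subrr.
Qed.

Section Algebraic.
Variables (r : R) (p : {poly R}).
Hypotheses (Ap : p \is a polyOver A) (p0 : p != 0) (pr0 : p.[r] = 0).
Hypothesis p_min : forall g, g \is a polyOver A -> g.[r] = 0 ->
  (size g < size p)%N -> g = 0.

Let d := lead_coef p.
Let Ad : d \in A. Proof. by rewrite /d lead_coefE (polyOverP Ap). Qed.
Let d0 : d != 0. Proof. by rewrite lead_coef_eq0. Qed.

Let size_p : (1 < size p)%N.
Proof.
rewrite ltnNge; apply/negP => /size1_polyC pC.
by move: pr0 p0; rewrite pC hornerC => ->; rewrite eqxx.
Qed.

(* Every nonzero ideal of A[r] meets A nontrivially. *)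
Lemma algebraic_multiple b : b \in adjoin A r -> b != 0 ->
  exists c, [/\ c \in A, c != 0 & exists2 e, e \in adjoin A r & c = b * e].
Proof.
move=> /adjoinP[g Ag bE] b0.
(* [I] collects the sizes of polynomials over [A] whose value at [r] is a nonzero multiple of [b]; a
   constant of this kind is the desired [c]. *)
pose I := [pred n | `[< exists g', [/\ g' \is a polyOver A, size g' = n,
  g'.[r] != 0 & exists2 e, e \in adjoin A r & g'.[r] = b * e] >]].
have exI : exists n, I n.
  exists (size g); apply/asboolP; exists g; split; rewrite -?bE //.
  by exists 1; rewrite ?rpred1 ?mulr1.
case: (ex_minnP exI) => n /asboolP[g1 [Ag1 <- g1r [e Ae g1E]]] g1_min {exI}.
(* Pseudo-division by [p] only multiplies the value at [r] by [d ^+ m], so a minimal [g1] is shorter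
   than [p]. *)
have lt_g1p : (size g1 < size p)%N.
  rewrite ltnNge; apply/negP => le_pg1.
  have [m [s [h [As Ah lth eqh]]]] := pseudo_division Ag1 Ap p0.
  have hrE : h.[r] = d ^+ m * g1.[r].
    by rewrite -hornerZ eqh hornerD hornerM pr0 mulr0 add0r.
  suff /g1_min : I (size h) by lia.
  apply/asboolP; exists h; split=> //; first by rewrite hrE mulf_neq0 ?expf_neq0.
  exists (d ^+ m * e); last by rewrite hrE g1E mulrCA.
  by apply: rpredM => //; apply: rpredX; apply: sub_adjoin.
have g10 : g1 != 0 by apply: contraNneq g1r => ->; rewrite horner0.
have [le_g1 | g1_gt1] := leqP (size g1) 1.
  have g1C := size1_polyC le_g1; exists g1`_0; split.
  - exact: (polyOverP Ag1).
  - by rewrite -polyC_eq0 -g1C.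
  - by exists e; rewrite // -g1E g1C hornerC coefC.
(* A nonconstant [g1] is impossible. The remainder [h] of [p] by [g1] also takes a multiple of [b]
   at [r]: if nonzero, it contradicts the choice of [g1]; if zero, [p_min] kills [h] and then the
   quotient [s], which is shorter than [p]. *)
have [m [s [h [As Ah lth eqh]]]] := pseudo_division Ap Ag1 g10.
have hrE : h.[r] = - (s.[r] * g1.[r]).
  have: (lead_coef g1 ^+ m *: p).[r] = 0 by rewrite hornerZ pr0 mulr0.
  by rewrite eqh hornerD hornerM => /eqP; rewrite addrC addr_eq0 => /eqP.
have [hr0 | hr0] := eqVneq h.[r] 0.
  have h0 : h = 0 by apply: p_min => //; lia.
  have sr0 : s.[r] = 0.
    by apply/eqP; move: hr0; rewrite hrE => /eqP; rewrite oppr_eq0 mulf_eq0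
      (negPf g1r) orbF.
  have lg1 : lead_coef g1 ^+ m != 0 by rewrite expf_neq0 ?lead_coef_eq0.
  have s0 : s != 0.
    apply: contraNneq p0 => s0; move: eqh.
    by rewrite s0 h0 mul0r addr0 => /eqP; rewrite scale_poly_eq0 (negPf lg1).
  have := congr1 (size \o polyseq) eqh.
  rewrite /= h0 addr0 size_scale // size_mul // => szp.
  by case/eqP: s0; apply: p_min => //; lia.
suff /g1_min : I (size h) by lia.
apply/asboolP; exists h; split=> //; exists (- (s.[r] * e)).
  by rewrite rpredN rpredM //; apply/adjoinP; exists s.
by rewrite hrE g1E mulrN mulrCA.
Qed.

(** A nonzero multiple [c] of [b] in [A] has a power divisible by [q] in [A[r]]. Reducing the
    cofactor modulo [p] costs a power of [d], and comparing constant terms brings the divisibility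
    down to [A]. *)
Lemma inverted_by_algebraic :
  inverted_by Q (adjoin A r) -> inverted_by Q A.
Proof.
move=> [b [Ab b0 Qinv]].
have [c [Ac c0 [e Ae cE]]] := algebraic_multiple Ab b0.
exists (d * c); split; rewrite ?rpredM ?mulf_neq0 // => q Qq.
have [n [t At bE]] := Qinv q Qq.
have /adjoinP[g Ag gE] : t * e ^+ n \in adjoin A r by rewrite rpredM ?rpredX.
have [m [s [h [As Ah lth eqh]]]] := pseudo_division Ag Ap p0.
have hE : q * h.[r] = d ^+ m * c ^+ n.
  have -> : h.[r] = d ^+ m * g.[r].
    by rewrite -hornerZ eqh hornerD hornerM pr0 mulr0 add0r.
  by rewrite -gE cE exprMn bE mulrCA !mulrA.
have Ah0 : h`_0 \in A by apply: (polyOverP Ah).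
(* The extra factor [d ^+ n * c ^+ m] completes [d ^+ m * c ^+ n] to a power of [d * c]. *)
exists (m + n)%N, (d ^+ n * c ^+ m * h`_0); first by rewrite !(rpredM, rpredX).
(* 1, r, ..., r^(deg p - 1) are linearly independent over A. *)
suff qh0 : d ^+ m * c ^+ n = q * h`_0.
  by rewrite mulrCA -qh0 exprMn !exprD; ring.
have: (d ^+ m * c ^+ n)%:P - q *: h = 0.
  apply: p_min.
  - apply: rpredB; last by apply: polyOverZ; rewrite ?QA.
    by rewrite polyOverC; apply: rpredM; apply: rpredX.
  - by rewrite hornerD hornerN hornerZ hornerC hE subrr.
  apply: leq_ltn_trans (size_polyD _ _) _; rewrite size_polyN gtn_max.
  rewrite (leq_ltn_trans (size_polyC_leq1 _)) //=.
  exact: leq_ltn_trans (size_scale_leq _ _) lth.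
move=> /(congr1 (fun f : {poly R} => f`_0)).
by rewrite coefB coefC coefZ coef0 => /eqP; rewrite subr_eq0 => /eqP.
Qed.

End Algebraic.

Lemma inverted_by_descent r :
  inverted_by Q (adjoin A r) -> inverted_by Q A.
Proof.
pose I := [pred n | `[< exists p, [/\ p \is a polyOver A, p != 0,
   p.[r] = 0 & size p = n] >]].
have [exI | noI] := pselect (exists n, I n); last first.
  apply: inverted_by_transcendental => p Ap pr0; apply/eqP/negPn/negP => p0.
  by apply: noI; exists (size p); apply/asboolP; exists p.
case: (ex_minnP exI) => n /asboolP[p [Ap p0 pr0 <-]] p_min.
apply: (inverted_by_algebraic Ap p0 pr0) => g Ag gr0 ltgp.
apply/eqP/negPn/negP => g0.
suff /p_min : I (size g) by lia.
by apply/asboolP; exists g.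
Qed.

End Descent.

(** Induction on the generators with [A] varying: the hypothesis for the remaining generators
    reaches [A[r]], and one descent step reaches [A]. With no generators left, [A] is all of [R]. *)
Lemma inverted_by_fg (R : idomainType) (Q : R -> Prop) (s : seq R)
    (A : subringClosed R) :
  (forall q, Q q -> q \in A) ->
  (forall S : subringClosed R, {subset A <= S} -> {subset s <= S} ->
     forall x, x \in S) ->
  inverted_by Q predT -> inverted_by Q A.
Proof.
move=> QA genA Qinv; elim: s A QA genA => [|r s IHs] A QA genA.
  have AT x : x \in A by apply: genA.
  have [a [_ a0 ainv]] := Qinv; exists a; split=> // q /ainv[n [t _ tE]].
  by exists n, t.
apply: (inverted_by_descent QA (r := r)); apply: IHs => [q Qq|S AS sS x].
  by rewrite sub_adjoin ?QA.
apply: genA => [y Ay|y]; first exact/AS/sub_adjoin.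
by rewrite inE => /predU1P[->|/sS//]; apply/AS/mem_adjoin.
Qed.

(** * Elements integral over a field, and subfields of a finitely generated domain *)

Section AlgebraicElements.
Variables (k : fieldType) (R : idomainType) (i : {rmorphism k -> R}).

Local Notation "p ^i" := (map_poly i p).

Lemma integralOver_nonzero_root (p : {poly k}) x :
  p != 0 -> p^i.[x] = 0 -> integralOver i x.
Proof.
move=> p0 px0; exists ((lead_coef p)^-1 *: p).
  by rewrite monicE lead_coefZ mulVf ?lead_coef_eq0.
by rewrite map_polyZ /root hornerZ px0 mulr0.
Qed.

(** The inverse is a polynomial in [x]: cancel [x] from the equation until its constant term [c] is
    nonzero, then [x p(x) = - c]. *)
Lemma integralOver_inverse x : integralOver i x -> x != 0 ->
  exists2 y, integralOver i y & x * y = 1.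
Proof.
move=> [p pmonic /rootP px0] x0.
suff [q xq1] : exists q : {poly k}, x * q^i.[x] = 1.
  exists q^i.[x] => //; apply: integral_horner; last by exists p => //; apply/rootP.
  by apply/integral_poly => j; rewrite coef_map; apply: integral_id.
(* Only [p != 0] is kept, being what the induction needs. *)
have := monic_neq0 pmonic; elim/poly_ind: p px0 {pmonic} => [|p c IHp].
  by rewrite eqxx.
rewrite rmorphD rmorphM /= map_polyX map_polyC hornerMXaddC /= => px0 p0.
have [c0 | c0] := eqVneq c 0.
  apply: IHp; last by apply: contraNneq p0 => ->; rewrite mul0r c0 addr0.
  by apply/eqP; move/eqP: px0; rewrite c0 raddf0 addr0 mulf_eq0 (negPf x0) orbF.
exists (- c^-1 *: p); rewrite map_polyZ hornerZ mulrCA [x * _]mulrC.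
move/eqP: px0; rewrite addr_eq0 => /eqP ->.
by rewrite rmorphN mulrNN -rmorphM mulVf ?rmorph1.
Qed.

Definition poly_values (x : R) : {pred R} :=
  fun y => `[< exists p : {poly k}, y = p^i.[x] >].

Lemma poly_valuesP x y :
  reflect (exists p : {poly k}, y = p^i.[x]) (y \in poly_values x).
Proof. exact: asboolP. Qed.

Lemma poly_values_subring_closed x : GRing.subring_closed (poly_values x).
Proof.
split=> [|_ _ /poly_valuesP[p ->] /poly_valuesP[q ->]|
  _ _ /poly_valuesP[p ->] /poly_valuesP[q ->]]; apply/poly_valuesP.
- by exists 1; rewrite rmorph1 hornerC.
- by exists (p - q); rewrite rmorphB hornerD hornerN.
- by exists (p * q); rewrite rmorphM hornerM.
Qed.

(* If a(x) inverts all of k[x], then 1 + x a(x) divides a power of a(x), to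
   which it is coprime. *)
Lemma transcendental_not_inverted x (A : subringClosed R) :
  ~ integralOver i x -> A =i poly_values x ->
  ~ inverted_by (fun q => q \in poly_values x /\ q != 0) A.
Proof.
move=> x_tr AE [a [+ a0 ainv]]; rewrite AE => /poly_valuesP[p aE].
have root0 (q : {poly k}) : q^i.[x] = 0 -> q = 0.
  move=> qx0; apply/eqP/negPn/negP => q0.
  exact: x_tr (integralOver_nonzero_root q0 qx0).
have p0 : p != 0 by apply: contraNneq a0 => p0; rewrite aE p0 map_poly0 horner0.
pose q := p * 'X + 1%:P.
have sz_q : size q = (size p).+1.
  by rewrite size_MXaddC (negPf p0).
have q0 : q != 0 by rewrite -size_poly_gt0 sz_q.
have [|n [_ /[!AE]/poly_valuesP[s ->] anE]] := ainv q^i.[x].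
  by split; [apply/poly_valuesP; exists q | apply/eqP => /root0/eqP; apply/negP].
have pnE : p ^+ n = q * s.
  apply/eqP; rewrite -subr_eq0; apply/eqP/root0.
  by rewrite rmorphB rmorphXn rmorphM hornerD hornerN hornerM horner_exp -aE anE
    subrr.
have cop : coprimep q (p ^+ n).
  apply: coprimep_expr; apply/Bezout_eq1_coprimepP; exists (1, - 'X).
  by rewrite /q /=; ring.
(* A divisor of [p ^+ n] coprime to it is coprime to itself, so [q] would have size 1; but its size
   is one more than that of the nonzero [p]. *)
move: cop; rewrite pnE coprimepMr coprimepp sz_q => /andP[].
by rewrite eqSS size_poly_eq0 (negPf p0).
Qed.

(** A non-integral [x] in [S] would make all nonzero elements of [k[x]] invertible in [R]; descent
    to [k[x]] contradicts [transcendental_not_inverted]. *)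
Lemma subfield_integral (s : seq R) :
  (forall S : subringClosed R, (forall c, i c \in S) -> {subset s <= S} ->
     forall x, x \in S) ->
  forall S : set R, subfield S -> (forall c, S (i c)) ->
  forall x, S x -> integralOver i x.
Proof.
move=> gen S [S_ring S_inv] kS x Sx; apply/not_notP => x_tr.
have S_sub p : S (map_poly i p).[x].
  have S_semi : GRing.semiring_closed (mem S) := S_ring.
  have [[S0 SD] [S1 SM]] := S_semi.
  elim/poly_ind: p => [|p c IHp]; first by rewrite map_poly0 horner0; apply/set_mem.
  rewrite rmorphD rmorphM /= map_polyX map_polyC hornerMXaddC /=.
  by apply/set_mem/SD; [apply: SM|]; apply/mem_set.
pose A : subringClosed R := HB.pack_for (subringClosed R) (poly_values x)
  (GRing.isSubringClosed.Build R (poly_values x) (poly_values_subring_closed x)).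
have AE : A =i poly_values x by [].
apply: (transcendental_not_inverted x_tr AE).
apply: (inverted_by_fg (s := s)) => [q [] //|B AB sB|].
  apply: gen => // c; apply: AB; rewrite AE; apply/poly_valuesP; exists c%:P.
  by rewrite map_polyC hornerC.
(* Nonzero values of polynomials at [x] lie in [S] and are invertible there, so they already divide
   1. *)
exists 1; split=> // [|q [/poly_valuesP[p ->] q0]]; first exact: oner_neq0.
by have [y _ pxy] := S_inv _ (S_sub p) q0; exists 1, y; rewrite // pxy.
Qed.

End AlgebraicElements.

(** * Homomorphisms from [k[t, t^-1]] correspond to units *)

Section LaurentEvaluation.
Variables (k : fieldType) (R : comUnitAlgType k).

Local Notation "x %:F" := (tofrac x).

Lemma lrmorphism_laurent_poly (f : {lrmorphism laurent k -> R}) (p : {poly k}) :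
  f (laurent_of_poly p) = horner_alg (f (laurentX k)) p.
Proof.
have of_polyC c : laurent_of_poly c%:P = c *: 1 by apply: val_inj; rewrite /= mulr1.
elim/poly_ind: p => [|p c IHp].
  have -> : laurent_of_poly (0 : {poly k}) = 0 by apply: val_inj; rewrite /= rmorph0.
  by rewrite !rmorph0.
have -> : laurent_of_poly (p * 'X + c%:P) =
    laurent_of_poly p * laurentX k + c *: 1.
  rewrite -of_polyC; apply: val_inj.
  by rewrite /= rmorphD rmorphM.
by rewrite rmorphD rmorphM /= linearZ /= rmorph1 IHp rmorphD rmorphM /=
  horner_algX horner_algC.
Qed.

Lemma laurent_relation (f : laurent k) n p :
  val f * ('X^n)%:F = p%:F -> f * laurentX k ^+ n = laurent_of_poly p.
Proof.
by move=> fE; apply: val_inj; rewrite rmorphM rmorphXn /= -fE rmorphXn.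
Qed.

Lemma lrmorphism_laurent_relation (f : {lrmorphism laurent k -> R})
    (g : laurent k) n p :
  val g * ('X^n)%:F = p%:F ->
  f g * f (laurentX k) ^+ n = horner_alg (f (laurentX k)) p.
Proof.
move=> /laurent_relation/(congr1 f).
by rewrite rmorphM rmorphXn lrmorphism_laurent_poly.
Qed.

Lemma lrmorphism_laurentX_unit (f : {lrmorphism laurent k -> R}) :
  f (laurentX k) \is a GRing.unit.
Proof.
apply/unitrPr; exists (f (laurentXV k)).
by rewrite -rmorphM laurentXK rmorph1.
Qed.

(** Clearing the denominator of [h] reduces to polynomials in [t]; the power of the unit [f t] can
    then be cancelled. *)
Lemma lrmorphism_laurent_eq (f g : {lrmorphism laurent k -> R}) :
  g (laurentX k) = f (laurentX k) -> g =1 f.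
Proof.
move=> gf h; have /laurent_predP[n [p hE]] := valP h.
apply: (mulIr (unitrX n (lrmorphism_laurentX_unit f))).
by rewrite (lrmorphism_laurent_relation f hE) -gf
  (lrmorphism_laurent_relation g hE).
Qed.

Variable u : R.
Hypothesis u_unit : u \is a GRing.unit.

(** Quantifying over all representations [p / X^n] records that [p(u) / u^n] is independent of the
    choice: two of them satisfy [p X^m = q X^n], which is evaluated at [u]. *)
Lemma laurent_eval_subproof (f : laurent k) :
  exists y : R, forall n (p : {poly k}),
    val f * ('X^n)%:F = p%:F -> y * u ^+ n = horner_alg u p.
Proof.
have /laurent_predP[n [p fE]] := valP f.
exists (horner_alg u p / u ^+ n) => m q fE'.
have pq : p * 'X^m = q * 'X^n.
  by apply/eqP; rewrite -tofrac_eq; apply/eqP; rewrite !rmorphM /= -fE -fE' mulrAC.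
have := congr1 (horner_alg u) pq.
rewrite !rmorphM !rmorphXn /= horner_algX => puE.
by rewrite mulrAC puE mulrK ?unitrX.
Qed.

Definition laurent_eval (f : laurent k) : R :=
  projT1 (cid (laurent_eval_subproof f)).

Lemma laurent_evalP (f : laurent k) n (p : {poly k}) :
  val f * ('X^n)%:F = p%:F -> laurent_eval f * u ^+ n = horner_alg u p.
Proof. exact: (projT2 (cid (laurent_eval_subproof f))). Qed.

Lemma laurent_eval_linear : linear laurent_eval.
Proof.
move=> a f g; have /laurent_predP[n [p fE]] := valP f.
have /laurent_predP[m [q gE]] := valP g.
(* It suffices to compare numerators over the common denominator [X^(n + m)]. *)
apply: (mulIr (unitrX (n + m) u_unit)).
have /laurent_evalP-> : val (a *: f + g) * ('X^(n + m))%:F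
    = (a%:P * p * 'X^m + q * 'X^n)%:F.
  rewrite /= exprD tofracD !tofracM -gE -fE mulrDl; congr (_ + _).
    by rewrite !mulrA.
  by rewrite -mulrA; congr (_ * _); rewrite mulrC.
rewrite rmorphD !rmorphM !rmorphXn /= horner_algX horner_algC.
rewrite -(laurent_evalP fE) -(laurent_evalP gE) exprD mulr_algl mulrDl.
rewrite !scalerAl mulrA; congr (_ + _).
by rewrite -mulrA [u ^+ m * _]mulrC.
Qed.

Lemma laurent_eval_monoid_morphism : monoid_morphism laurent_eval.
Proof.
split=> [|f g].
  have E : val (1 : laurent k) * ('X^0)%:F = 1%:F by rewrite expr0 mulr1.
  by have := laurent_evalP E; rewrite expr0 mulr1 rmorph1.
have /laurent_predP[n [p fE]] := valP f.
have /laurent_predP[m [q gE]] := valP g.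
apply: (mulIr (unitrX (n + m) u_unit)).
have /laurent_evalP-> : val (f * g) * ('X^(n + m))%:F = (p * q)%:F.
  by rewrite /= exprD !tofracM -gE -fE mulrACA.
by rewrite rmorphM /= -(laurent_evalP fE) -(laurent_evalP gE) exprD mulrACA.
Qed.

HB.instance Definition _ :=
  GRing.isLinear.Build k (laurent k) R *:%R laurent_eval laurent_eval_linear.
HB.instance Definition _ :=
  GRing.isMonoidMorphism.Build (laurent k) R laurent_eval
    laurent_eval_monoid_morphism.

Lemma laurent_lrmorphism_exists :
  exists f : {lrmorphism laurent k -> R}, f (laurentX k) = u.
Proof.
exists laurent_eval.
have E : val (laurentX k) * ('X^0)%:F = 'X%:F by rewrite expr0 mulr1.
by have := laurent_evalP E; rewrite expr0 mulr1 horner_algX.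
Qed.

End LaurentEvaluation.

(** A fraction [p / t^n] in the kernel has its numerator [p] killed at the image of [t], and
    conversely [k[t]] embeds in [laurent k]. *)
Lemma laurent_lrmorphism_injective (k : fieldType) (R : comUnitAlgType k)
    (f : {lrmorphism laurent k -> R}) :
  (forall p : {poly k}, horner_alg (f (laurentX k)) p = 0 -> p = 0) <->
  injective f.
Proof.
split=> [t_tr | f_inj p].
  apply: raddf_inj => g fg0; have /laurent_predP[n [p gE]] := valP g.
  have p0 : p = 0.
    by apply: t_tr; rewrite -(lrmorphism_laurent_relation f gE) fg0 mul0r.
  apply: val_inj; apply/eqP; move: gE; rewrite p0 rmorph0 => /eqP.
  by rewrite mulf_eq0 tofrac_eq0 expf_eq0 polyX_eq0 andbF orbF.
rewrite -lrmorphism_laurent_poly -(rmorph0 f) => /f_inj /(congr1 val) /= pE.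
by apply/eqP; rewrite -tofrac_eq; apply/eqP; rewrite pE rmorph0.
Qed.

(** * The integral closure of [k] and unit-additivity *)

Section FinitelyGeneratedDomain.
Variables (k : fieldType) (R : comUnitAlgType k).
Hypotheses (R_domain : GRing.integral_domain_axiom R) (R_fg : fg_algebra R).

(** Packs the domain hypothesis into a structure on the same carrier, so that the results on
    [idomainType] apply to [R]. *)
Let Rdom : idomainType := HB.pack_for idomainType (GRing.ComUnitAlgebra.sort R)
  (GRing.ComUnitRing_isIntegral.Build (GRing.ComUnitAlgebra.sort R) R_domain).
Let alg : {rmorphism k -> Rdom} := in_alg R.
Let L : set R := integral_closure R.

(** Finite generation is stated with subalgebras; a subring containing the scalars [c%:A] is one,
    since [a *: u = a%:A * u]. *)
Lemma subfield_over_integral (S : set R) : subfield_over S -> S `<=` L.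
Proof.
move=> [S_field kS]; have [s gen] := R_fg.
apply: (@subfield_integral k Rdom alg s _ S S_field kS) => B kB sB x.
have BT : [set y : R | y \in B] = setT.
  apply: gen => [|y /sB//]; split.
  - by apply/mem_set; exact: (rpred1 B).
  - move=> a u v /set_mem uB /set_mem vB; apply/mem_set.
    rewrite -[a *: u]mulr_algl.
    exact: (@rpredD _ B) (@rpredM _ B _ _ (kB a) uB) vB.
  - move=> u v /set_mem uB /set_mem vB; apply/mem_set.
    exact: (@rpredM _ B).
by have : [set y : R | y \in B] x by rewrite BT.
Qed.

Lemma integral_closure_inverse x : L x -> x != 0 -> exists2 y, L y & x * y = 1.
Proof. exact: (@integralOver_inverse k Rdom alg). Qed.

Lemma integral_closure_subfield_over : subfield_over L.
Proof.
split; last by move=> c; apply: (@integral_id _ _ (in_alg R)).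
split; last exact: integral_closure_inverse.
split=> [|u v /set_mem uL /set_mem vL|u v /set_mem uL /set_mem vL]; apply/mem_set.
- exact: (@integral1 _ _ (in_alg R)).
- exact: (@integral_sub _ _ (in_alg R)).
- exact: (@integral_mul _ _ (in_alg R)).
Qed.

Lemma unit_group_integral_closure x :
  unit_group L x <-> L x /\ x \is a GRing.unit.
Proof.
split=> [[Lx [y _ xy1]] | [Lx x_unit]].
  by split=> //; apply/unitrPr; exists y.
split=> //; apply: integral_closure_inverse => //.
by apply: contraTneq x_unit => ->; rewrite unitr0.
Qed.

Lemma transcendental_laurent_injective (f : {lrmorphism laurent k -> R}) :
  injective f <-> ~ L (f (laurentX k)).
Proof.
split=> [/laurent_lrmorphism_injective f_inj [p pmonic /rootP px0] | t_tr].
  by move: (monic_neq0 pmonic); rewrite (f_inj p px0) eqxx.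
apply/laurent_lrmorphism_injective => p pt0; apply/eqP/negPn/negP => p0.
exact: t_tr (@integralOver_nonzero_root k Rdom alg p _ p0 pt0).
Qed.

(* Unit-additivity makes the units, together with 0, a subfield. *)
Lemma unit_additive_units_integral (u : R) :
  unit_additive R -> u \is a GRing.unit -> L u.
Proof.
move=> R_ua u_unit; pose S : set R := [set x | x \is a GRing.unit \/ x = 0].
suff : subfield_over S by move=> /subfield_over_integral; apply; left.
have nil0 (x : R) : nilpotent_elt x -> x = 0.
  move=> [n xn0]; apply/eqP.
  by have := expf_eq0 (x : Rdom) n; rewrite xn0 eqxx => /esym/andP[].
(* For units, [x - y] is the sum of the units [x] and [- y], hence a unit or nilpotent, and a
   nilpotent element of a domain is zero. *)
have SB (x y : R) : S x -> S y -> S (x - y).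
  move=> [x_unit|->] [y_unit|->].
  - have [|?|/nil0] := R_ua x (- y) x_unit; first by rewrite unitrN.
      by left.
    by right.
  - by rewrite subr0; left.
  - by rewrite sub0r; left; rewrite unitrN.
  - by rewrite subr0; right.
split; last first.
  move=> c; have [->|c0] := eqVneq c 0; first by right; rewrite scale0r.
  left; apply/unitrPr; exists c^-1%:A.
  by rewrite -[LHS](rmorphM (in_alg R)) mulfV // rmorph1.
split; last first.
  move=> x [x_unit _|->]; last by rewrite eqxx.
  by exists x^-1; [left; rewrite unitrV | rewrite mulrV].
split=> [|u1 v /set_mem uS /set_mem vS|u1 v /set_mem uS /set_mem vS]; apply/mem_set.
- by left; apply: unitr1.
- exact: SB.
- move: uS vS => [u1_unit|->] [v_unit|->]; rewrite ?mul0r ?mulr0; try by right.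
  by left; rewrite unitrMl.
Qed.

(** A sum of two units lies in [L], which is a field, so it is zero or invertible. *)
Lemma integral_units_unit_additive :
  (forall u : R, u \is a GRing.unit -> L u) -> unit_additive R.
Proof.
move=> unitL u v /unitL Lu /unitL Lv.
have Luv : L (u + v) by apply: (@integral_add _ _ (in_alg R)).
have [->|uv0] := eqVneq (u + v) 0; first by right; exists 1; rewrite expr1.
left; have [y _ uvy] := integral_closure_inverse Luv uv0.
by apply/unitrPr; exists y.
Qed.

End FinitelyGeneratedDomain.

Theorem theorem4p1 (k : fieldType) (R : comUnitAlgType k)
    (R_domain : GRing.integral_domain_axiom R) (R_fg : fg_algebra R) :
  let L : set R := integral_closure R in
  let A := laurent k in
  let t : A := laurentX k in
  let case1 :=
    [/\ unit_additive R,
        (forall f : {lrmorphism A -> R}, unit_group L (f t)),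
        (forall a : R, unit_group L a ->
           exists f : {lrmorphism A -> R},
             f t = a /\ (forall g : {lrmorphism A -> R}, g t = a -> g =1 f)),
        [set u : R | u \is a GRing.unit] = unit_group L
      & forall f : {lrmorphism A -> R}, ~ injective f] in
  let case2 :=
    ~ unit_additive R /\ exists f : {lrmorphism A -> R}, injective f in
  [/\ maximal_subfield_over L,
      (forall S : set R, maximal_subfield_over S -> S = L)
    & (case1 \/ case2) /\ ~ (case1 /\ case2)].
Proof.
move=> L A t case1 case2.
have L_field : subfield_over L := integral_closure_subfield_over R_domain.
have sub_L (S : set R) : subfield_over S -> S `<=` L :=
  subfield_over_integral R_domain R_fg (S := S).
have unitL x : unit_group L x <-> L x /\ x \is a GRing.unit :=
  unit_group_integral_closure R_domain x.
have injL (f : {lrmorphism A -> R}) : injective f <-> ~ L (f t) :=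
  transcendental_laurent_injective R_domain f.
split.
- by split=> // T T_field LT; apply/seteqP; split; first exact: sub_L.
- by move=> S [S_field S_max]; rewrite (S_max L) //; exact: sub_L.
split; last by move=> [[R_ua _ _ _ _] []].
(* The dichotomy is whether every unit of [R] is integral over [k]; a unit outside [L] serves as the
   image of [t] in the second case. *)
have [u_L | /existsNP[u /not_implyP[u_unit Lu]]] :=
  pselect (forall u : R, u \is a GRing.unit -> L u).
  left; split.
  - exact: integral_units_unit_additive.
  - move=> f; apply/unitL; have f_unit := lrmorphism_laurentX_unit f.
    by split; first exact: u_L.
  - move=> a /unitL[_ /laurent_lrmorphism_exists[f fa]]; exists f; split=> //.
    by move=> g ga; apply: lrmorphism_laurent_eq; rewrite ga -fa.
  - apply/seteqP; split=> x; last by move=> /unitL[].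
    by move=> x_unit; apply/unitL; split; first exact: u_L.
  - by move=> f /injL; apply; apply/u_L/lrmorphism_laurentX_unit.
right; split; first by move=> R_ua; apply: Lu; exact: unit_additive_units_integral.
have [f fu] := laurent_lrmorphism_exists u_unit.
by exists f; apply/injL; rewrite fu.
Qed.
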